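(* Let $X$ be a Banach space having property $(\alpha)$. Then for every Banach space $Y$, every $S\in B(X,Y)$ and every closed subspace $R(X,Y)$ of $B(X,Y)$ containing $F(X,Y)$, the set $$\mathcal{N}(S):=\{T\in R(X,Y):\ S+T \text{ does not attain strongly its norm}\}$$ is a $\sigma$-porous subset of $R(X,Y)$. In particular (with $S=0$), $NAR(X,Y)$ is the complement of a $\sigma$-porous subset of $R(X,Y)$.
   Context: Banach spaces are real. $B(X,Y)$ is the space of all bounded linear operators from $X$ to $Y$ with the operator norm, and $F(X,Y)$ is its subspace of finite-rank operators. $S_X$ is the unit sphere of $X$. An operator $T\in B(X,Y)$ is said to be norm attaining (resp. norm strongly attaining, i.e. to attain strongly its norm) if there is an $x_0\in S_X$ such that $\|T\|=\|T(x_0)\|$ (resp. such that $\|T(x_n)\|\to\|T\|=\|T(x_0)\|$ implies that $\|x_n-x_0\|\to 0$). $NAR(X,Y)$ denotes the set of norm attaining operators in $R(X,Y)$. Property $(\alpha)$: $X$ has property $(\alpha)$ if there exist families $\{x_\lambda:\lambda\in\Lambda\}\subset X$ and $\{x^*_\lambda:\lambda\in\Lambda\}\subset X^*$ such that: 1) $\|x_\lambda\|=\|x^*_\lambda\|=\langle x^*_\lambda,x_\lambda\rangle=1$ for all $\lambda\in\Lambda$; 2) there is a constant $\rho$ with $0<\rho<1$ such that $|\langle x^*_\lambda,x_\mu\rangle|\le\rho$ for all $\lambda,\mu\in\Lambda$ with $\lambda\ne\mu$; 3) the absolute convex hull of $\{x_\lambda:\lambda\in\Lambda\}$ is dense in the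 unit ball of $X$. $\sigma$-porosity: a subset $A$ of a metric space $M$ is porous in $M$ if there exist $\lambda_0\in(0,1]$ and $r_0>0$ such that for any $x\in M$ and $r\in(0,r_0]$ there exists $y\in M$ such that $\mathring{B}(y;\lambda_0 r)\subset\mathring{B}(x;r)\cap(M\setminus A)$, where $\mathring{B}(x;r)$ denotes the open ball of $M$ centered at $x$ with radius $r$. $A$ is $\sigma$-porous in $M$ if it can be represented as a countable union of porous sets in $M$. Here $M=R(X,Y)$ with the operator norm.
   Formalization: Strong norm attainment is taken up to sign (norm-one x_n with ‖T(x_n)‖→‖T‖ must satisfy min(‖x_n−x_0‖,‖x_n+x_0‖)→0), since read literally x_n=−x_0 defeats it for every T; and Y is assumed nonzero, since the claim fails for Y=0, X=ℓ_1^2. *)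

(* Defs.v *)
(* Real Banach spaces are completeNormedModType R with R : realType.          *)
From HB Require Import structures.
From mathcomp Require Import all_boot all_order all_algebra.
From mathcomp Require Import all_classical all_reals all_analysis.

Set Implicit Arguments.
Unset Strict Implicit.
Unset Printing Implicit Defensive.
Import Order.TTheory GRing.Theory Num.Theory.
Import numFieldNormedType.Exports.
Local Open Scope classical_set_scope.
Local Open Scope ring_scope.

Section BoundedOperators.
Context {R : realType} (X Y : normedModType R).

Definition bounded_linear : {pred X -> Y} :=
  [pred f | `[< linear f /\ exists C : R, forall x, `|f x| <= C * `|x| >]].

Lemma bounded_linear_submod_closed : submod_closed bounded_linear.
Proof.
split=> [|a f g].
  apply/asboolP; split=> [b x y|]; first by rewrite /= scaler0 addr0.
  by exists 0 => x; rewrite normr0 mul0r.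
move=> /asboolP[lf [C Cf]] /asboolP[lg [D Dg]]; apply/asboolP; split.
  move=> b x y; rewrite !fctE lf lg !scalerDr !scalerA [b * a]mulrC.
  by rewrite addrACA.
exists (`|a| * C + D) => x; rewrite !fctE (le_trans (ler_normD _ _))//.
by rewrite normrZ mulrDl lerD// -mulrA ler_wpM2l.
Qed.

HB.instance Definition _ :=
  GRing.isSubmodClosed.Build _ _ bounded_linear bounded_linear_submod_closed.

(* The space B(X, Y), normed below by the operator norm.                      *)
Record boundedOp := BoundedOp {
  boundedOp_fun :> X -> Y;
  boundedOpP : boundedOp_fun \in bounded_linear }.

HB.instance Definition _ := [isSub for boundedOp_fun].
HB.instance Definition _ := [Choice of boundedOp by <:].
HB.instance Definition _ := [SubChoice_isSubLmodule of boundedOp by <:].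

Lemma boundedOp_linear (T : boundedOp) : linear T.
Proof. by have /asboolP[] := boundedOpP T. Qed.

HB.instance Definition _ (T : boundedOp) :=
  GRing.isLinear.Build R X Y *:%R T (boundedOp_linear T).

Definition opnorm (T : boundedOp) : R :=
  sup [set `|T x| | x in [set x : X | `|x| <= 1]].

Lemma opnorm_has_sup (T : boundedOp) :
  has_sup [set `|T x| | x in [set x : X | `|x| <= 1]].
Proof.
split; first by exists `|T 0|, 0 => //=; rewrite normr0.
have /asboolP[_ [C CT]] := boundedOpP T.
exists `|C| => _ [x /= x1 <-]; rewrite (le_trans (CT x))//.
rewrite (le_trans (ler_wpM2r _ (ler_norm C)))//.
by rewrite -[leRHS]mulr1 ler_wpM2l.
Qed.

Lemma opnorm_ub (T : boundedOp) x : `|x| <= 1 -> `|T x| <= opnorm T.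
Proof.
by move=> x1; apply: sup_upper_bound; [exact: opnorm_has_sup|exists x].
Qed.

Lemma opnorm_le (T : boundedOp) (c : R) :
  (forall x, `|x| <= 1 -> `|T x| <= c) -> opnorm T <= c.
Proof.
move=> Tc; apply: ge_sup; first by case: (opnorm_has_sup T).
by move=> _ [x /= x1 <-]; exact: Tc.
Qed.

Lemma opnormD (S T : boundedOp) : opnorm (S + T) <= opnorm S + opnorm T.
Proof.
apply: opnorm_le => x x1; rewrite (le_trans (ler_normD _ _))//.
by rewrite lerD ?opnorm_ub.
Qed.

Lemma opnorm_leZ (a : R) (T : boundedOp) : opnorm (a *: T) <= `|a| * opnorm T.
Proof. by apply: opnorm_le => x x1; rewrite normrZ ler_wpM2l ?opnorm_ub. Qed.

Lemma opnormZ (a : R) (T : boundedOp) : opnorm (a *: T) = `|a| * opnorm T.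
Proof.
have [->|a0] := eqVneq a 0.
  rewrite scale0r normr0 mul0r; apply/eqP; rewrite eq_le; apply/andP; split.
    by apply: opnorm_le => x _; rewrite normr0.
  by rewrite (le_trans _ (@opnorm_ub _ 0 _))// normr0.
apply/eqP; rewrite eq_le opnorm_leZ /=.
rewrite -ler_pdivlMl ?normr_gt0// -normfV.
by rewrite -[in leLHS](scalerK a0 T) opnorm_leZ.
Qed.

Lemma opnorm_eq0 (T : boundedOp) : opnorm T = 0 -> T = 0.
Proof.
move=> T0; apply/val_inj/funext => x; rewrite -[RHS]/(0 : Y) /=.
have [->|x0] := eqVneq x 0; first by rewrite linear0.
have nx0 : `|x| != 0 by rewrite normr_eq0.
have := @opnorm_ub T (`|x|^-1 *: x).
rewrite normrZ normfV normr_id mulVf// lexx T0 => /(_ isT).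
rewrite linearZ normr_le0 scaler_eq0 invr_eq0 (negPf nx0) /=.
by move/eqP.
Qed.

HB.instance Definition _ :=
  Lmodule_isNormed.Build R boundedOp opnormD opnormZ opnorm_eq0.

Definition finite_rank (T : boundedOp) : Prop :=
  exists (n : nat) (b : 'I_n -> Y),
    forall x, exists c : 'I_n -> R, T x = \sum_i c i *: b i.

Definition norm_attaining (T : boundedOp) : Prop :=
  exists2 x0 : X, `|x0| = 1 & `|T x0| = `|T|.

(* Since |T (- x0)| = |T x0|, a maximizing sequence can only be required to   *)
(* converge to x0 up to sign, i.e. to the pair {x0, - x0}: the distance to    *)
(* this pair is the minimum below. Asking for u --> x0 would be contradicted  *)
(* by the constant sequence - x0, and no operator would satisfy it.           *)
Definition norm_strongly_attaining (T : boundedOp) : Prop :=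
  exists x0 : X, [/\ `|x0| = 1, `|T x0| = `|T| &
    forall u : nat -> X, (forall n, `|u n| = 1) ->
      `|T (u n)| @[n --> \oo] --> `|T| ->
      Num.min `|u n - x0| `|u n + x0| @[n --> \oo] --> (0 : R)].

End BoundedOperators.

Section PropertyAlpha.
Context {R : realType} (X : normedModType R).

Definition absolutely_convex (A : set X) : Prop :=
  forall (x y : X) (a b : R), A x -> A y -> `|a| + `|b| <= 1 ->
    A (a *: x + b *: y).

(* The empty set is absolutely convex and is its own hull, so the zero space  *)
(* does not have property (alpha).                                            *)
Definition absolute_convex_hull (G : set X) : set X :=
  smallest absolutely_convex G.

(* The dual of X is boundedOp X R^o. In the last clause (density), the hull   *)
(* is contained in the unit ball because the x l are unit vectors.            *)
Definition property_alpha : Prop :=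
  exists (Lambda : Type) (x : Lambda -> X) (x' : Lambda -> boundedOp X R^o),
  [/\ forall l, [/\ `|x l| = 1, `|x' l| = 1 & x' l (x l) = 1],
      exists rho : R, [/\ 0 < rho, rho < 1 &
        forall l m, l <> m -> `|x' l (x m)| <= rho] &
      [set z : X | `|z| <= 1] `<=` closure (absolute_convex_hull (range x))].

End PropertyAlpha.

Section Porosity.
Context {R : realType} {V : pseudoMetricType R}.

(* M is regarded as a metric space of its own: its open balls are the traces  *)
(* on M of those of V.                                                        *)
Definition porous (M A : set V) : Prop :=
  A `<=` M /\
  exists l0 r0 : R, [/\ 0 < l0, l0 <= 1, 0 < r0 &
    forall x r, M x -> 0 < r -> r <= r0 ->
      exists2 y, M y &
        ball y (l0 * r) `&` M `<=` (ball x r `&` M) `&` (M `\` A)].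

Definition sigma_porous (M A : set V) : Prop :=
  exists2 F : nat -> set V, (forall n, porous M (F n)) & A = \bigcup_n F n.

End Porosity.

(* Main.v *)
Require Import Defs.
From HB Require Import structures.
From mathcomp Require Import all_boot all_order all_algebra.
From mathcomp Require Import all_classical all_reals all_analysis.
From mathcomp Require Import lra.

Set Implicit Arguments.
Unset Strict Implicit.
Unset Printing Implicit Defensive.
Import Order.TTheory GRing.Theory Num.Theory.
Import numFieldNormedType.Exports.
Local Open Scope classical_set_scope.
Local Open Scope ring_scope.

(** Since the hull of the points x_l is dense in the unit ball of X, an
    operator T has norm sup_l |T x_l|.  The theorem follows from two facts about
    this supremum.

    A strict maximum is attained strongly.  Suppose |T x_m| <= c < |T x_l| for
    all m <> l.  A point z of the hull is a x_l + v, where v is a combination of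
    the other generators with total weight at most 1 - |a|; hence
    |T z| <= |a| |T x_l| + (1 - |a|) c, so |T z| can be close to |T x_l| only if
    |a| is close to 1, that is, only if z is close to x_l or - x_l.
    Quantitatively, the distance from z to {x_l, - x_l} is at most
    2 (|T x_l| - |T z|) / (|T x_l| - c), and this estimate passes to the closure
    of the hull (peak_estimate).

    A strict maximum can be created by a rank-one perturbation, and it is
    stable.  Given T and r, pick l such that |(S + T) x_l| is almost |S + T|, and
    add to T the operator x'_l ⊗ y with |y| = r / 2 and y in the direction of
    (S + T) x_l.  The value at x_l gains r / 2 in norm, whereas by property
    (alpha) the value at any other x_m gains at most rho r / 2.  The resulting
    gap, of order (1 - rho) r, survives all perturbations of norm less than
    (1 - rho) r / 8.  The set of operators T for which S + T fails to attain its
    norm strongly is therefore not only sigma-porous but porous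
    (strongly_attaining_failure_porous). *)

(** * Bounded operators *)

Lemma opnorm_apply (R : realType) (X Y : normedModType R)
    (T : boundedOp X Y) (z : X) : `|T z| <= `|T| * `|z|.
Proof.
have [->|z0] := eqVneq z 0; first by rewrite linear0 !normr0 mulr0.
have nz : 0 < `|z| by rewrite normr_gt0.
rewrite -ler_pdivrMr// mulrC.
have := @opnorm_ub _ _ _ T (`|z|^-1 *: z).
by rewrite linearZ !normrZ normfV normr_id mulVf ?gt_eqF//; apply.
Qed.

Lemma boundedOp_continuous (R : realType) (X Y : normedModType R)
    (T : boundedOp X Y) : continuous T.
Proof.
apply: bounded_linear_continuous; exists `|T|; split=> // c Tc.
apply: filterS (nbhsx_ballx (0 : X) 1 ltr01) => z.
rewrite -ball_normE /= sub0r normrN => z1.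
apply: le_trans (opnorm_apply T z) _; apply: le_trans (ltW Tc).
by rewrite ler_piMr// ltW.
Qed.

Section RankOne.
Context {R : realType} {X Y : normedModType R}.
Variables (f : boundedOp X R^o) (y : Y).

Let rank_one_fun (z : X) : Y := f z *: y.

Let rank_one_bounded_linear : rank_one_fun \in @bounded_linear R X Y.
Proof.
apply/asboolP; split=> [a u v|].
  by rewrite /rank_one_fun linearP scalerDl scalerA.
by exists (`|f| * `|y|) => z; rewrite normrZ mulrAC ler_wpM2r// opnorm_apply.
Qed.

Definition rank_one : boundedOp X Y := BoundedOp rank_one_bounded_linear.

Lemma rank_oneE z : rank_one z = f z *: y. Proof. by []. Qed.

Lemma rank_one_finite_rank : finite_rank rank_one.
Proof.
exists 1%N, (fun=> y) => z; exists (fun=> f z).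
by rewrite big_ord_recl big_ord0 addr0.
Qed.

Lemma norm_rank_one_le : `|rank_one| <= `|f| * `|y|.
Proof.
apply: opnorm_le => z z1; rewrite rank_oneE normrZ ler_wpM2r//.
exact: opnorm_ub.
Qed.

End RankOne.

(** Moving in the direction of v itself gains the full length of the step; for
    v = 0 every direction does, which is where the nonzero vector y enters. *)
Lemma norm_additive_step (R : realType) (Y : normedModType R) (y v : Y) (c : R) :
  y != 0 -> 0 <= c -> exists2 w : Y, `|w| = c & `|v + w| = `|v| + c.
Proof.
move=> y0 c0; have [->|v0] := eqVneq v 0.
  exists ((c / `|y|) *: y); rewrite ?add0r ?normr0 ?add0r;
  by rewrite normrZ ger0_norm ?divr_ge0// divfK// normr_eq0.
have nv : `|v| != 0 by rewrite normr_eq0.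
exists ((c / `|v|) *: v).
  by rewrite normrZ ger0_norm ?divr_ge0// divfK.
rewrite -{1}[v]scale1r -scalerDl normrZ ger0_norm ?addr_ge0 ?divr_ge0//.
by rewrite mulrDl mul1r divfK.
Qed.

(** * Density of the absolutely convex hull *)

(** A bounds the hull and C its closure.  They differ in the study of a strict
    maximum: there A describes how the points of the hull decompose, and C is
    cut out by a continuous inequality that holds on A. *)
Lemma unit_ball_sub_closed (R : realType) (X : normedModType R) (Lambda : Type)
    (x : Lambda -> X) (A C : set X) :
  [set z : X | `|z| <= 1] `<=` closure (absolute_convex_hull (range x)) ->
  absolutely_convex A -> (forall l, A (x l)) -> closed C -> A `<=` C ->
  forall z, `|z| <= 1 -> C z.
Proof.
move=> dense cA Ax Ccl AC z /dense; rewrite (iffLR (closure_id _) Ccl).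
apply: closureS; apply: subset_trans AC; apply: smallest_sub => //.
by move=> _ [l _ <-].
Qed.

(** The points where T has norm at most c form a closed absolutely convex set. *)
Lemma opnorm_le_generators (R : realType) (X Y : normedModType R)
    (Lambda : Type) (x : Lambda -> X) (T : boundedOp X Y) (c : R) :
  [set z : X | `|z| <= 1] `<=` closure (absolute_convex_hull (range x)) ->
  (forall l, `|T (x l)| <= c) -> `|T| <= c.
Proof.
move=> dense Tc; apply: opnorm_le.
apply: (unit_ball_sub_closed dense (A := [set z | `|T z| <= c])) => //.
- move=> u v a b /= Tu Tv ab; rewrite linearD !linearZ.
  apply: le_trans (ler_normD _ _) _; rewrite !normrZ.
  have c0 : 0 <= c by exact: le_trans Tu.
  have := ler_wpM2l (normr_ge0 a) Tu; have := ler_wpM2l (normr_ge0 b) Tv.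
  have := ler_wpM2r c0 ab; lra.
- apply: (@closed_comp _ _ (fun z => `|T z|) [set t | t <= c]) => [z _|].
    by apply: cvg_norm; exact: boundedOp_continuous.
  exact: closed_le.
Qed.

(** * A strict maximum over the generators is attained strongly *)

Section Peak.
Context {R : realType} {X Y : normedModType R} {Lambda : Type}.
Variables (x : Lambda -> X) (T : boundedOp X Y) (l : Lambda) (c : R).
Hypothesis x_unit : forall m, `|x m| = 1.
Hypothesis x_dense :
  [set z : X | `|z| <= 1] `<=` closure (absolute_convex_hull (range x)).
Hypothesis c_ge0 : 0 <= c.
Hypothesis c_lt : c < `|T (x l)|.
Hypothesis T_le : forall m, m <> l -> `|T (x m)| <= c.

(** The set of all a x_l + v, where v collects the contribution of the other
    generators: their total weight is at most 1 - |a|, of which only the effect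
    on |v| and on |T v| is retained. *)
Let split_hull : set X := [set z | exists (a : R) (v : X),
  [/\ z = a *: x l + v, `|a| + `|v| <= 1 & `|T v| <= (1 - `|a|) * c]].

Let split_hull_convex : absolutely_convex split_hull.
Proof.
move=> z1 z2 p q [a [v [-> av Tv]]] [b [w [-> bw Tw]]] pq.
exists (p * a + q * b), (p *: v + q *: w).
have ab : `|p * a + q * b| <= `|p| * `|a| + `|q| * `|b|.
  by apply: le_trans (ler_normD _ _) _; rewrite !normrM.
have pav := ler_wpM2l (normr_ge0 p) av; have qbw := ler_wpM2l (normr_ge0 q) bw.
split.
- by rewrite !scalerDr !scalerA addrACA -scalerDl.
- have := ler_normD (p *: v) (q *: w); rewrite !normrZ; lra.
- rewrite linearD !linearZ; apply: le_trans (ler_normD _ _) _; rewrite !normrZ.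
  have := ler_wpM2l (normr_ge0 p) Tv; have := ler_wpM2l (normr_ge0 q) Tw.
  have : (`|p| * (1 - `|a|) + `|q| * (1 - `|b|)) * c
      <= (1 - `|p * a + q * b|) * c by apply: ler_wpM2r => //; lra.
  lra.
Qed.

Let split_hull_generators m : split_hull (x m).
Proof.
have [->|ml] := EM (m = l).
  by exists 1, 0; rewrite scale1r addr0 linear0 !normr0 normr1 subrr mul0r addr0.
exists 0, (x m); rewrite scale0r add0r normr0 add0r subr0 mul1r x_unit.
by split=> //; exact: T_le.
Qed.

Let dist (z : X) : R := Num.min `|z - x l| `|z + x l|.

Let split_hull_estimate :
  split_hull `<=` [set z | (`|T (x l)| - c) * dist z + 2 * `|T z|
                           <= 2 * `|T (x l)|].
Proof.
move=> _ [a [v [-> av Tv]]] /=; set z := _ + v.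
have dz : dist z <= 2 * (1 - `|a|).
  rewrite /dist ge_min; have [a0|a0] := leP 0 a.
    rewrite ger0_norm// in av *; apply/orP; left.
    have -> : z - x l = v - (1 - a) *: x l.
      by rewrite /z scalerBl scale1r opprB addrA [v + _]addrC.
    apply: le_trans (ler_normB _ _) _.
    rewrite normrZ x_unit mulr1 ger0_norm; have := normr_ge0 v; lra.
  rewrite ltr0_norm// in av *; apply/orP; right.
  have -> : z + x l = v + (1 + a) *: x l.
    by rewrite /z scalerDl scale1r (addrC (x l)) addrA [v + _]addrC.
  apply: le_trans (ler_normD _ _) _.
  rewrite normrZ x_unit mulr1 ger0_norm; have := normr_ge0 v; lra.
have Tz : `|T z| <= `|a| * `|T (x l)| + (1 - `|a|) * c.
  rewrite /z linearD linearZ; apply: le_trans (ler_normD _ _) _.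
  by rewrite normrZ lerD2l.
have gap : 0 <= `|T (x l)| - c by rewrite subr_ge0 ltW.
have := ler_wpM2l gap dz; lra.
Qed.

(** The estimate is linear along the decomposition z = a x_l + v of a point of
    the hull, where dist z <= 2 (1 - |a|), and both sides are continuous. *)
Lemma peak_estimate z : `|z| <= 1 ->
  (`|T (x l)| - c) * Num.min `|z - x l| `|z + x l|
    <= 2 * (`|T (x l)| - `|T z|).
Proof.
move=> z1; rewrite mulrBr lerBrDr.
apply: (unit_ball_sub_closed x_dense split_hull_convex split_hull_generators
  _ split_hull_estimate) z1.
apply: (@closed_comp _ _ (fun z => (`|T (x l)| - c) * dist z + 2 * `|T z|)
  [set t | t <= 2 * `|T (x l)|]) => [{}z _|]; last exact: closed_le.
apply: cvgD; apply: cvgM; try exact: cvg_cst.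
  apply: (@continuous_min _ _ (fun u => `|u - x l|) (fun u => `|u + x l|)).
    by apply: cvg_norm; apply: cvgB; [exact: cvg_id|exact: cvg_cst].
  by apply: cvg_norm; apply: cvgD; [exact: cvg_id|exact: cvg_cst].
by apply: cvg_norm; exact: boundedOp_continuous.
Qed.

Lemma peak_strongly_attaining : norm_strongly_attaining T.
Proof.
have gap : 0 < `|T (x l)| - c by rewrite subr_gt0.
have min_ge0 z : 0 <= Num.min `|z - x l| `|z + x l| by rewrite le_min !normr_ge0.
have normT : `|T (x l)| = `|T|.
  apply/eqP; rewrite eq_le opnorm_ub ?x_unit//=; apply: opnorm_le => z z1.
  have := mulr_ge0 (ltW gap) (min_ge0 z); have := peak_estimate z1; lra.
exists (x l); split=> // u u1 Tu.
pose bound n := (`|T| - c)^-1 * (2 * (`|T| - `|T (u n)|)).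
apply: (@squeeze_cvgr _ _ _ _ (fun=> 0) bound); last 2 first.
- exact: cvg_cst.
- have -> : 0 = (`|T| - c)^-1 * (2 * (`|T| - `|T|)) by rewrite subrr !mulr0.
  apply: cvgMr; apply: cvgMr; apply: cvgB => //; exact: cvg_cst.
apply: nearW => n; rewrite min_ge0 /bound /=.
by rewrite -normT -ler_pdivrMl ?invr_gt0// invrK peak_estimate ?u1.
Qed.

End Peak.

(** * Porosity *)

Lemma near_maximal_generator (R : realType) (X Y : normedModType R)
    (Lambda : Type) (x : Lambda -> X) (T : boundedOp X Y) (e : R) :
  [set z : X | `|z| <= 1] `<=` closure (absolute_convex_hull (range x)) ->
  0 < e -> exists l, `|T| - e < `|T (x l)|.
Proof.
move=> dense e0; apply: contrapT => /forallNP small.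
suff : `|T| <= `|T| - e by lra.
by apply: opnorm_le_generators dense _ => l; rewrite leNgt; apply/negP.
Qed.

(** The centre of the hole in the ball of radius r around T is T + K, where K is
    the rank-one operator x'_l ⊗ w. *)
Lemma strongly_attaining_failure_porous (R : realType)
    (X Y : normedModType R) (X_alpha : property_alpha X)
    (Y_neq0 : exists y : Y, y != 0) (M : set (boundedOp X Y))
    (M_add : forall T U, M T -> M U -> M (T + U))
    (M_finite_rank : forall T : boundedOp X Y, finite_rank T -> M T)
    (S : boundedOp X Y) :
  porous M [set T | M T /\ ~ norm_strongly_attaining (S + T)].
Proof.
have [Lambda [x [x' [unit [rho [rho0 rho1 x'_le]] dense]]]] := X_alpha.
have [y0 y0_neq0] := Y_neq0.
have x1 m : `|x m| = 1 by case: (unit m).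
split=> [T []//|]; exists ((1 - rho) / 8), 1; split=> [|||T r MT r0 _]; [lra..|].
(* The gap (1 - rho) r / 2 created by K equals 4 e; an error e is lost in the
   choice of l, and another e at x_l and at the other x_m each when T + K is
   replaced by an operator U at distance less than e. *)
set e := _ * r.
have eE : e = (r - rho * r) / 8 by rewrite /e; lra.
have rhor : rho * r < r by rewrite gtr_pMl.
have rhor0 : 0 < rho * r by rewrite mulr_gt0.
have e0 : 0 < e by lra.
have [l Tl] := near_maximal_generator (S + T) dense e0.
have [_ x'l1 x'l] := unit l.
have r2 : 0 <= r / 2 by lra.
have [w w_norm Tl_w] := norm_additive_step ((S + T) (x l)) y0_neq0 r2.
pose K := rank_one (x' l) w.
have normK : `|K| <= r / 2.
  by rewrite (le_trans (norm_rank_one_le _ _))// x'l1 w_norm mul1r.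
exists (T + K).
  by apply: M_add => //; apply/M_finite_rank/rank_one_finite_rank.
move=> U []; rewrite -!ball_normE /= => UK MU.
have TU : `|T - U| < r.
  have -> : T - U = (T + K - U) - K by rewrite addrAC addrK.
  by have := ler_normB (T + K - U) K; lra.
split=> //; split=> // -[_]; apply.
pose D := U - (T + K).
have D_le m : `|D (x m)| <= e.
  have := opnorm_ub D (x := x m); rewrite x1 lexx => /(_ isT).
  have : `|D| < e by rewrite distrC.
  rewrite -[opnorm D]/(`|D|); lra.
have SU m : (S + U) (x m) = (S + T) (x m) + x' l (x m) *: w + D (x m).
  have -> : S + U = S + T + K + D by rewrite /D -(addrA S) -(addrA S) subrKC.
  by [].
apply: (@peak_strongly_attaining _ _ _ _ x _ l (`|S + T| + rho * r / 2 + e)) => //.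
- by have := normr_ge0 (S + T); lra.
- rewrite SU x'l scale1r.
  have := lerB_normD ((S + T) (x l) + w) (D (x l)); have := D_le l.
  rewrite Tl_w; lra.
- move=> m ml; rewrite SU.
  have STm : `|(S + T) (x m)| <= `|S + T| by apply: opnorm_ub; rewrite x1.
  have wm : `|x' l (x m) *: w| <= rho * r / 2.
    rewrite normrZ w_norm -mulrA ler_wpM2r// x'_le//; exact/nesym.
  apply: le_trans (ler_normD _ _) _; apply: lerD; last exact: D_le.
  by apply: le_trans (ler_normD _ _) _; exact: lerD.
Qed.

Lemma porous_subset (R : realType) (V : pseudoMetricType R) (M A B : set V) :
  B `<=` A -> porous M A -> porous M B.
Proof.
move=> BA [AM [l0 [r0 [l00 l01 r00 hole]]]].
split; first exact: subset_trans AM.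
exists l0, r0; split=> // x r Mx r_gt0 rr0; have [y My yr] := hole x r Mx r_gt0 rr0.
exists y => // z /yr[? [? nAz]]; split=> //; split=> // /BA; exact: nAz.
Qed.

Lemma porous_sigma_porous (R : realType) (V : pseudoMetricType R)
    (M A : set V) : porous M A -> sigma_porous M A.
Proof.
move=> pA; exists (fun=> A) => //; apply/seteqP; split=> [z Az|z [_ _ //]].
by exists 0%N.
Qed.

Theorem corollary4 (R : realType) (X : completeNormedModType R)
    (X_alpha : property_alpha X)
    (Y : completeNormedModType R) (Y_neq0 : exists y : Y, y != 0)
    (M : set (boundedOp X Y))
    (M_subspace : submod_closed (mem M)) (M_closed : closed M)
    (M_finite_rank : forall T : boundedOp X Y, finite_rank T -> M T) :
  (forall S : boundedOp X Y,
    sigma_porous M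
      [set T | M T /\ ~ norm_strongly_attaining (S + T)]) /\
  (exists2 A : set (boundedOp X Y), sigma_porous M A &
    [set T | M T /\ norm_attaining T] = M `\` A).
Proof.
have M_add T U : M T -> M U -> M (T + U).
  move=> MT MU; have := M_subspace.2 1 T U.
  by rewrite scale1r !inE; apply.
have failure_porous S := strongly_attaining_failure_porous
  X_alpha Y_neq0 M_add M_finite_rank S.
split=> [S|]; first exact/porous_sigma_porous/failure_porous.
exists [set T | M T /\ ~ norm_attaining T].
  (* Strong attainment implies attainment, so this set is contained in the
     porous set obtained for S = 0. *)
  apply/porous_sigma_porous/(porous_subset _ (failure_porous 0)) => T [MT nT].
  split=> //; rewrite add0r => -[x0 [x01 Tx0 _]]; apply: nT.
  by exists x0.
apply/seteqP; split=> T [MT]; first by split=> // -[].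
by move=> nT; split=> //; apply: contrapT => nT'; apply: nT.
Qed.
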